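(* Assume $\operatorname{epi}(z)\neq\emptyset$ and let $(x^*,\eta^* )\in\mathbb{R}^n\times\mathbb{R}$. Then $$(\operatorname{epi}(z)-(x^*,\eta^* ))^- = \begin{pmatrix} H^\top & 0\\ 0 & -1\end{pmatrix}\cdot P^{\le}(x^*,\eta^* ),$$ that is, $(\operatorname{epi}(z)-(x^*,\eta^* ))^- = \{(H^\top\gamma,-\gamma_0) : (\gamma,\gamma_0)\in P^{\le}(x^*,\eta^* )\}$.
   Context: Let $H \in \mathbb{R}^{m\times n}$, $A\in\mathbb{R}^{m\times k}$, $b\in\mathbb{R}^m$, $d\in\mathbb{R}^k$. Define $z(x) := \min_{y\in\mathbb{R}^k}\{d^\top y : Ay \le b-Hx\}$ for $x\in\mathbb{R}^n$, with epigraph $$\operatorname{epi}(z) = \{(x,\eta)\in\mathbb{R}^n\times\mathbb{R} : \exists y\in\mathbb{R}^k:\ Ay\le b-Hx,\ d^\top y\le\eta\}.$$ The relaxed alternative polyhedron is $$P^{\le}(x^*,\eta^* ) := \{(\gamma,\gamma_0)\in\mathbb{R}^m\times\mathbb{R} : \gamma,\gamma_0\ge 0,\ \gamma^\top A+\gamma_0 d^\top=0,\ \gamma^\top(b-Hx^* )+\gamma_0\eta^*\le-1\}.$$ For a convex set $C\subseteq\mathbb{R}^N$, the reverse polar set is $C^- := \{c\in\mathbb{R}^N : c^\top u\le -1 \text{ for all } u\in C\}$; here $\mathbb{R}^N=\mathbb{R}^n\times\mathbb{R}$. *)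

(* Defs.v *)
From HB Require Import structures.
From mathcomp Require Import all_boot all_order all_algebra.
From mathcomp Require Import classical_sets reals.

Set Implicit Arguments.
Unset Strict Implicit.
Unset Printing Implicit Defensive.

Import Order.TTheory GRing.Theory Num.Theory.
Local Open Scope classical_set_scope.
Local Open Scope ring_scope.

(* R^N is 'cV[R]_N, and R^n x R is identified with R^(n + 1). *)

Definition dotp (R : realType) (N : nat) (u v : 'cV[R]_N) : R :=
  (u^T *m v) 0 0.

Definition lev (R : realType) (N : nat) (u v : 'cV[R]_N) : Prop :=
  forall i, u i 0 <= v i 0.

Definition pt (R : realType) (n : nat) (x : 'cV[R]_n) (eta : R) :
  'cV[R]_(n + 1) := col_mx x eta%:M.

(* The epigraph of z(x) = min {d^T y : A y <= b - H x}.  It is given directly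
   by feasible y, so no value has to be assigned to z at those x where the
   linear program is infeasible or unbounded. *)
Definition epi_z (R : realType) (m n k : nat) (H : 'M[R]_(m, n))
    (A : 'M[R]_(m, k)) (b : 'cV[R]_m) (d : 'cV[R]_k) : set 'cV[R]_(n + 1) :=
  [set u | exists (x : 'cV[R]_n) (eta : R), u = pt x eta /\
     exists y : 'cV[R]_k, lev (A *m y) (b - H *m x) /\ dotp d y <= eta].

Definition relaxed_alt_polyhedron (R : realType) (m n k : nat)
    (H : 'M[R]_(m, n)) (A : 'M[R]_(m, k)) (b : 'cV[R]_m) (d : 'cV[R]_k)
    (xs : 'cV[R]_n) (etas : R) : set 'cV[R]_(m + 1) :=
  [set v | exists (g : 'cV[R]_m) (g0 : R), v = pt g g0 /\
     [/\ lev 0 g, 0 <= g0, g^T *m A + g0 *: d^T = 0 &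
         dotp g (b - H *m xs) + g0 * etas <= -1]].

Definition reverse_polar (R : realType) (N : nat) (C : set 'cV[R]_N) :
  set 'cV[R]_N := [set c | forall u, C u -> dotp c u <= -1].

(* Main.v *)
(* The valid inequalities of a nonempty polyhedron are, by the affine Farkas
   lemma, exactly the nonnegative combinations of its defining ones, weakened on
   the right-hand side.  Applied to the polyhedron
   {(x, eta, y) | H x + A y <= b, d^T y <= eta}, whose projection is epi(z),
   the multipliers (gamma, gamma_0) of such a combination form a point of the
   relaxed alternative polyhedron. *)
Require Import Defs.
From HB Require Import structures.
From mathcomp Require Import all_boot all_order all_algebra.
From mathcomp Require Import classical_sets reals.
From mathcomp Require Import boolp.
From mathcomp Require Import lra.

Set Implicit Arguments.
Unset Strict Implicit.
Unset Printing Implicit Defensive.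

Import Order.TTheory GRing.Theory Num.Theory.
Local Open Scope classical_set_scope.
Local Open Scope ring_scope.

Lemma mulmx_ge0 (R : realType) (m : nat) (g : 'rV[R]_m) (v : 'cV[R]_m) :
  (forall i, 0 <= g 0 i) -> lev 0 v -> 0 <= (g *m v) 0 0.
Proof.
move=> g0 v0; rewrite mxE; apply: sumr_ge0 => i _; apply: mulr_ge0 => //.
by have := v0 i; rewrite mxE.
Qed.

Lemma lev_col_mx (R : realType) (m p : nat) (u u' : 'cV[R]_m)
    (v v' : 'cV[R]_p) :
  lev (col_mx u v) (col_mx u' v') <-> lev u u' /\ lev v v'.
Proof.
split=> [h|[hu hv] i].
  split=> i; first by have := h (lshift p i); rewrite !col_mxEu.
  by have := h (rshift m i); rewrite !col_mxEd.
by rewrite !mxE; case: split => j.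
Qed.

Lemma lev0P (R : realType) (m : nat) (u : 'cV[R]_m) :
  lev u 0 <-> forall i, u i 0 <= 0.
Proof. by split=> h i; have := h i; rewrite (mxE _ _ i 0). Qed.

Lemma lev_cV1 (R : realType) (u v : 'cV[R]_1) :
  lev u v <-> u 0 0 <= v 0 0.
Proof. by split=> [/(_ 0)//|h i]; rewrite (ord1 i). Qed.

(* Induction on the number of rows, after D. Bartl.  If some x satisfies the
   inequalities of M but not that of c, then a x > 0 for the extra row a;
   projecting along x onto the hyperplane a = 0 eliminates the row a. *)
Lemma farkas_homogeneous (R : realType) (m N : nat) (M : 'M[R]_(m, N))
    (c : 'rV[R]_N) :
  (forall x : 'cV_N, lev (M *m x) 0 -> (c *m x) 0 0 <= 0) ->
  exists2 g : 'rV_m, (forall i, 0 <= g 0 i) & g *m M = c.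
Proof.
elim: m M c => [|m IH] M c.
  move=> h; exists 0 => [i|]; first by rewrite mxE.
  rewrite mul0mx; apply/esym/rowP => j; rewrite mxE.
  (* With no rows every vector is feasible, so both signs of a unit vector can be tested against
     [c], which forces [c = 0]. *)
  have hz (s : R) : s * c 0 j <= 0.
    have : (c *m (s *: delta_mx j 0 : 'cV_N)) 0 0 <= 0 by apply: h; case.
    by rewrite -scalemxAr -colE !mxE.
  by apply/eqP; rewrite eq_le; have := hz 1; have := hz (-1); lra.
rewrite -[m.+1]/(1 + m)%N in M *.
rewrite -[M]vsubmxK; move: (usubmx M) (dsubmx M) => {M} a M h.
have ext (g : 'rV_m) (t : R) : (forall i, 0 <= g 0 i) -> 0 <= t ->
    t *: a + g *m M = c ->
    exists2 g' : 'rV_(1 + m), (forall i, 0 <= g' 0 i) & g' *m col_mx a M = c.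
  move=> g0 t0 e; exists (row_mx t%:M g); last first.
    by rewrite mul_row_col mul_scalar_mx.
  by move=> i; rewrite mxE; case: splitP => j _ //; rewrite (ord1 j) mxE mulr1n.
(* If [M] alone already implies the inequality of [c], the row [a] gets multiplier 0. *)
have [/IH[g g0 e]|] := pselect (forall x : 'cV_N, lev (M *m x) 0 ->
    (c *m x) 0 0 <= 0).
  by apply: (ext g 0) => //; rewrite scale0r add0r.
move=> /existsNP[x /not_implyP[Mx /negP]]; rewrite -ltNge => cx.
have ax : 0 < (a *m x) 0 0.
  rewrite ltNge; apply/negP => ax; move: cx; apply/negP; rewrite -leNgt.
  apply: h; rewrite mul_col_mx -[0]vsubmxK; apply/lev_col_mx.
  rewrite !linear0; split=> //.
  by apply/lev_cV1; rewrite [leRHS]mxE.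
pose x1 := ((a *m x) 0 0)^-1 *: x.
have ax1 : a *m x1 = 1.
  rewrite /x1 -scalemxAr; apply/matrixP => i j.
  by rewrite (ord1 i) (ord1 j) mxE [RHS]mxE mulVf // gt_eqF.
have iax : 0 <= ((a *m x) 0 0)^-1 by rewrite invr_ge0 ltW.
have cx1 : 0 <= (c *m x1) 0 0.
  by rewrite -scalemxAr mxE mulr_ge0 // ltW.
have Mx1 : lev (M *m x1) 0.
  apply/lev0P => i; rewrite -scalemxAr mxE mulr_ge0_le0 //.
  by move: i; apply/lev0P.
(* Since [a x1 = 1], the map sending y to y - x1 (a y) is the projection onto a = 0 along [x1]; [M]
   and [c] are composed with it. The projected point satisfies the row [a] with equality, so [h]
   applies to it. *)
have [g g0 e] : exists2 g : 'rV_m, (forall i, 0 <= g 0 i) &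
    g *m (M - M *m x1 *m a) = c - c *m x1 *m a.
  apply: IH => y hy.
  rewrite mulmxBl -2!mulmxA -mulmxBr; apply: h.
  rewrite mul_col_mx -[0]vsubmxK; apply/lev_col_mx; rewrite !linear0; split.
    rewrite mulmxBr !mulmxA ax1 mul1mx subrr.
    by apply/lev0P => i; rewrite mxE.
  by move: hy; rewrite mulmxBl -2!mulmxA -mulmxBr.
(* Expanding [e] gives c = g M + (c x1 - g M x1) a. The coefficient of [a] is nonnegative because c
   x1 >= 0, g >= 0 and M x1 <= 0. *)
apply: (ext g ((c *m x1) 0 0 - (g *m (M *m x1)) 0 0)) => //.
  rewrite subr_ge0 (le_trans _ cx1) // -oppr_ge0.
  have -> : - (g *m (M *m x1)) 0 0 = (g *m - (M *m x1)) 0 0.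
    by rewrite mulmxN [RHS]mxE.
  apply: mulmx_ge0 => // i; rewrite [leLHS]mxE [leRHS]mxE oppr_ge0.
  by move: i; apply/lev0P.
move: e; rewrite mulmxBr => /eqP; rewrite subr_eq => /eqP ->.
rewrite scalerBl -!mul_scalar_mx -!mx11_scalar !mulmxA.
by rewrite -(addrA c) (addrC (- _)) -[X in c + X]opprB addrC subrK.
Qed.

(* Homogenize with an extra variable t >= 0: for t > 0 divide by t, and for
   t = 0 use that x is a recession direction at the feasible point x0. *)
Lemma farkas_affine (R : realType) (m N : nat) (M : 'M[R]_(m, N))
    (beta : 'cV[R]_m) (c : 'rV[R]_N) (delta : R) :
  (exists x : 'cV_N, lev (M *m x) beta) ->
  (forall x : 'cV_N, lev (M *m x) beta -> (c *m x) 0 0 <= delta) ->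
  exists g : 'rV_m, [/\ forall i, 0 <= g 0 i, g *m M = c &
    (g *m beta) 0 0 <= delta].
Proof.
move=> [x0 Mx0] hM.
(* The rows encode M x - t beta <= 0 and -t <= 0, and the implied inequality is c x - t delta <=
   0. *)
have [x|g g0] := @farkas_homogeneous R (m + 1) (N + 1)
    (col_mx (row_mx M (- beta)) (row_mx 0 (-1)%:M)) (row_mx c (- delta)%:M).
  rewrite -[x]vsubmxK; move: (usubmx x) (dsubmx x) => {}x t'.
  rewrite [t']mx11_scalar; move: (t' 0 0) => {t'} t.
  rewrite mul_col_mx !mul_row_col mul0mx add0r -!scalar_mxM mulN1r mulNmx.
  rewrite mul_mx_scalar -[0]vsubmxK => /lev_col_mx; rewrite !linear0.
  move=> [/lev0P Mx /lev0P/(_ 0)]; rewrite mxE eqxx mulr1n oppr_le0 => t0.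
  rewrite mxE [X in _ + X]mxE eqxx mulr1n mulNr subr_le0.
  move: t0; rewrite le_eqVlt => /predU1P[t0|t_gt0].
    rewrite -t0 mulr0 leNgt; apply/negP => cx.
    have Mx' i : (M *m x) i 0 <= 0.
      by have := Mx i; rewrite -t0 scale0r subr0.
    (* This step length makes c (x0 + s x) at least |delta| + 1, contradicting the bound [delta]. *)
    pose s := (`|delta| + `|(c *m x0) 0 0| + 1) / (c *m x) 0 0.
    have s0 : 0 <= s by rewrite divr_ge0 ?(ltW cx) ?addr_ge0.
    have := hM (x0 + s *: x); rewrite mulmxDr -scalemxAr => h.
    have {h} : (c *m (x0 + s *: x)) 0 0 <= delta.
      apply: h => i; rewrite mxE [X in _ + X]mxE -[leRHS]addr0 lerD //.
      exact: mulr_ge0_le0.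
    rewrite mulmxDr -scalemxAr mxE [X in _ + X]mxE divfK ?gt_eqF //.
    have := ler_norm delta; have := ler_norm (- (c *m x0) 0 0).
    by rewrite normrN; lra.
  have := hM (t^-1 *: x); rewrite -!scalemxAr => h.
  suff : (t^-1 *: (c *m x)) 0 0 <= delta.
    by rewrite mxE mulrC ler_pdivrMr.
  apply: h => i; rewrite mxE mulrC ler_pdivrMr //.
  by have := Mx i; rewrite mxE [X in _ + X]mxE [X in _ - X]mxE subr_le0 mulrC.
rewrite -[g]hsubmxK in g0 *.
move: (lsubmx g) (rsubmx g) g0 => {}g s g0.
rewrite mul_row_col !mul_mx_row add_row_mx mulmx0 addr0 mul_mx_scalar.
(* The column of t reads g beta + s = delta, where s >= 0 is the multiplier of -t <= 0; hence g beta
   <= delta. *)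
move=> /eq_row_mx[gM]; rewrite mulmxN => /matrixP/(_ 0 0).
rewrite !mxE eqxx mulr1n mulN1r => e.
exists g; split=> //.
  by move=> i; have := g0 (lshift 1 i); rewrite row_mxEl.
have : 0 <= s 0 0 by have := g0 (rshift m 0); rewrite row_mxEr.
by rewrite mxE; lra.
Qed.

Lemma dotpB (R : realType) (N : nat) (u v w : 'cV[R]_N) :
  dotp u (v - w) = dotp u v - dotp u w.
Proof. by rewrite /dotp mulmxBr mxE [X in _ + X]mxE. Qed.

Lemma dotp_pt (R : realType) (n : nat) (x y : 'cV[R]_n) (s t : R) :
  dotp (pt x s) (pt y t) = dotp x y + s * t.
Proof.
rewrite /dotp tr_col_mx mul_row_col tr_scalar_mx -scalar_mxM mxE.
by rewrite [X in _ + X]mxE eqxx mulr1n.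
Qed.

Lemma dotp_trmul (R : realType) (m n : nat) (H : 'M[R]_(m, n)) (g : 'cV[R]_m)
    (x : 'cV[R]_n) :
  dotp (H^T *m g) x = dotp g (H *m x).
Proof. by rewrite /dotp trmx_mul trmxK mulmxA. Qed.

Lemma dotp_lev (R : realType) (m : nat) (g u v : 'cV[R]_m) :
  lev 0 g -> lev u v -> dotp g u <= dotp g v.
Proof.
move=> g0 uv; rewrite -subr_ge0 -dotpB; apply: mulmx_ge0 => i.
  by have := g0 i; rewrite !mxE.
by rewrite !mxE subr_ge0.
Qed.

Lemma ptP (R : realType) (n : nat) (u : 'cV[R]_(n + 1)) :
  exists x t, u = pt x t.
Proof.
by exists (usubmx u), (dsubmx u 0 0); rewrite /pt -mx11_scalar vsubmxK.
Qed.

Lemma pt_inj (R : realType) (n : nat) (x y : 'cV[R]_n) (s t : R) :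
  pt x s = pt y t -> x = y /\ s = t.
Proof.
move=> /eq_col_mx[-> /matrixP/(_ 0 0)].
by rewrite !mxE eqxx !mulr1n.
Qed.

(** Weak duality: weight A y <= b - H x by [g] and d^T y <= eta by [g0], then add. The terms in y
    cancel because g^T A + g0 d^T = 0. *)
Lemma relaxed_alt_sub_polar (R : realType) (m n k : nat) (H : 'M[R]_(m, n))
    (A : 'M[R]_(m, k)) (b : 'cV[R]_m) (d : 'cV[R]_k) (xs : 'cV[R]_n) (etas : R)
    (g : 'cV[R]_m) (g0 : R) :
  relaxed_alt_polyhedron H A b d xs etas (pt g g0) ->
  reverse_polar [set u - pt xs etas | u in epi_z H A b d]
    (pt (H^T *m g) (- g0)).
Proof.
move=> [_ [_ [/pt_inj[<- <-] [g_ge0 g0_ge0 gA gb]]]].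
move=> _ [_ [x [eta [-> [y [Ay dy]]]]] <-].
rewrite dotpB !dotp_pt !dotp_trmul.
have gAy : dotp g (A *m y) + g0 * dotp d y = 0.
  rewrite /dotp mulmxA; have /(congr1 (fun B => (B *m y) 0 0)) := gA.
  by rewrite mulmxDl mul0mx -scalemxAl mxE [X in _ + X]mxE [RHS]mxE.
have := dotp_lev g_ge0 Ay; rewrite dotpB => le1.
have := ler_wpM2l g0_ge0 dy; rewrite dotpB in gb; lra.
Qed.

Lemma polar_sub_relaxed_alt (R : realType) (m n k : nat) (H : 'M[R]_(m, n))
    (A : 'M[R]_(m, k)) (b : 'cV[R]_m) (d : 'cV[R]_k) (xs : 'cV[R]_n) (etas : R)
    (c : 'cV[R]_(n + 1)) :
  epi_z H A b d !=set0 ->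
  reverse_polar [set u - pt xs etas | u in epi_z H A b d] c ->
  exists g g0, relaxed_alt_polyhedron H A b d xs etas (pt g g0) /\
    c = pt (H^T *m g) (- g0).
Proof.
move=> [_ [x0 [eta0 [_ [y0 [Ay0 dy0]]]]]] hc.
have [p [r cE]] := ptP c.
(* The columns belong to x, eta and y; with right-hand side [pt b 0] the rows say H x + A y <= b and
   d^T y - eta <= 0. *)
pose M : 'M_(m + 1, n + 1 + k) :=
  block_mx (row_mx H 0) A (row_mx 0 (-1)%:M) d^T.
have ME x eta y : M *m col_mx (pt x eta) y =
    pt (H *m x + A *m y) (dotp d y - eta).
  rewrite mul_block_col !mul_row_col !mul0mx add0r addr0 -scalar_mxM mulN1r.
  by rewrite [d^T *m y]mx11_scalar -raddfD /= (addrC (- eta)).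
have MP x eta y : lev (M *m col_mx (pt x eta) y) (pt b 0) <->
    lev (A *m y) (b - H *m x) /\ dotp d y <= eta.
  rewrite ME; split=> [/lev_col_mx[h1 /(_ 0)]|[h1 h2]].
    rewrite !mxE eqxx !mulr1n subr_le0; split=> // i.
    by have := h1 i; rewrite !mxE lerBrDl.
  apply/lev_col_mx; split=> [i|]; first by have := h1 i; rewrite !mxE lerBrDl.
  by apply/lev_cV1; rewrite !mxE eqxx !mulr1n subr_le0.
(* The reverse polar condition on [c] is a valid inequality of the lifted polyhedron with
   coefficient 0 on y; moving the shift to the right gives its bound. *)
have [|z|g [g_ge0 gM gb]] := @farkas_affine R _ _ M (pt b 0) (row_mx c^T 0)
    (dotp c (pt xs etas) - 1).
- by exists (col_mx (pt x0 eta0) y0); apply/MP.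
- rewrite -[z]vsubmxK; have [x [eta ->]] := ptP (usubmx z).
  move/MP => hz; rewrite mul_row_col mul0mx addr0 -[leLHS]/(dotp c _).
  have : dotp c (pt x eta - pt xs etas) <= -1.
    apply: hc; exists (pt x eta) => //; exists x, eta; split=> //.
    by exists (dsubmx z).
  by rewrite dotpB; lra.
have [h [h0 gE]] := ptP g^T.
have {gE} gE : g = row_mx h^T h0%:M.
  by rewrite -[g]trmxK gE tr_col_mx tr_scalar_mx.
exists h, h0; subst g.
(* Comparing columns: x gives [p], eta gives [r], and y gives the equation h^T A + h0 d^T = 0. *)
move: gM; rewrite mul_row_block !mul_mx_row !mulmx0 add_row_mx.
rewrite cE tr_col_mx tr_scalar_mx add0r addr0 -scalar_mxM mulrN1.
rewrite !mul_scalar_mx => /eq_row_mx[/eq_row_mx[hH hr] hA].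
have rE : r = - h0.
  by move/matrixP/(_ 0 0): hr; rewrite !mxE eqxx !mulr1n.
have pE : p = H^T *m h by rewrite -[p]trmxK -hH trmx_mul trmxK.
split; last by rewrite pE rE.
exists h, h0; split=> //; split => //.
- by move=> i; rewrite mxE; have := g_ge0 (lshift 1 i); rewrite row_mxEl mxE.
- by have := g_ge0 (rshift m 0); rewrite row_mxEr mxE eqxx mulr1n.
move: gb; rewrite mul_row_col -scalar_mxM mulr0 raddf0 addr0.
by rewrite cE pE rE dotp_pt dotp_trmul dotpB -[leLHS]/(dotp h b); lra.
Qed.

Theorem theorem8 (R : realType) (m n k : nat) (H : 'M[R]_(m, n))
    (A : 'M[R]_(m, k)) (b : 'cV[R]_m) (d : 'cV[R]_k)
    (epi_neq0 : epi_z H A b d !=set0) (xs : 'cV[R]_n) (etas : R) :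
  reverse_polar [set u - pt xs etas | u in epi_z H A b d]
    = [set block_mx H^T 0 0 (-1)%:M *m v |
        v in relaxed_alt_polyhedron H A b d xs etas]
  /\
  reverse_polar [set u - pt xs etas | u in epi_z H A b d]
    = [set c | exists (g : 'cV[R]_m) (g0 : R),
        relaxed_alt_polyhedron H A b d xs etas (pt g g0) /\
        c = pt (H^T *m g) (- g0)].
Proof.
have mulE g g0 : block_mx H^T 0 0 (-1)%:M *m pt g g0 = pt (H^T *m g) (- g0).
  by rewrite mul_block_col !mul0mx addr0 add0r -scalar_mxM mulN1r.
suff polarE : reverse_polar [set u - pt xs etas | u in epi_z H A b d]
    = [set c | exists (g : 'cV[R]_m) (g0 : R),
        relaxed_alt_polyhedron H A b d xs etas (pt g g0) /\
        c = pt (H^T *m g) (- g0)].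
  split=> //; rewrite polarE; apply/seteqP; split=> c /=.
    by move=> [g [g0 [Pg ->]]]; exists (pt g g0).
  move=> [v Pv <-]; have [g [g0 vE]] := ptP v.
  by exists g, g0; rewrite -mulE -vE.
apply/seteqP; split=> c /=; first exact: polar_sub_relaxed_alt.
by move=> [g [g0 [Pg ->]]]; exact: relaxed_alt_sub_polar.
Qed.
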